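(* $\mathcal{SB}(\mathbb N_0)$ is a closed semigroup: if $A,B\in\mathcal{SB}(\mathbb N_0)$ then $AB\in\mathcal{SB}(\mathbb N_0)$, and if $B_n\in\mathcal{SB}(\mathbb N_0)$ and $B$ is a bounded operator on $l^1(\mathbb N_0)$ with $\lim_{n\to\infty}\|B_n-B\|_{l^1(\mathbb N_0)}=0$, then $B\in\mathcal{SB}(\mathbb N_0)$.
   Context: $\mathbb N_0=\{0,1,\dots\}$ and $l^1(\mathbb N_0)$ has norm $\|x\|_{l^1(\mathbb N_0)}=\sum_j|x_j|$; for operators on $l^1(\mathbb N_0)$, $\|\cdot\|_{l^1(\mathbb N_0)}$ denotes the operator norm. $\mathcal{SB}(\mathbb N_0)$ (semibistochastic operators) is the set of operators $\mathbf B:l^1(\mathbb N_0)\to l^1(\mathbb N_0)$, $(\mathbf Bx)_j=\sum_k\mathbf B_{jk}x_k$, with $\mathbf B_{jk}\ge0$ for all $j,k$, $\sum_{j}\mathbf B_{jk}\le1$ for every $k$, and $\sum_{k}\mathbf B_{jk}\le1$ for every $j$. *)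

(* Defs.v *)
From HB Require Import structures.
From mathcomp Require Import all_boot all_order all_algebra.
From mathcomp Require Import all_classical all_reals all_analysis.

Set Implicit Arguments.
Unset Strict Implicit.
Unset Printing Implicit Defensive.

Import Order.TTheory GRing.Theory Num.Theory.
Import numFieldNormedType.Exports.

Local Open Scope classical_set_scope.
Local Open Scope ring_scope.

Section l1_space.
Variable R : realType.

Definition l1_pred : {pred nat -> R} :=
  mem [set x : nat -> R | cvgn [normed series x]].

Lemma l1_submod_closed : submod_closed l1_pred.
Proof.
split.
  rewrite inE/=; apply/cvg_ex; exists 0.
  rewrite (_ : [normed series _] = cst 0); first exact: cvg_cst.
  by apply/funext => n; apply: big1 => i _; rewrite /= normr0.
move=> a u v; rewrite !inE/= => cu cv.
apply: (@series_le_cvg R _ (fun k => `|a| * `|u k| + `|v k|)).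
- by move=> n; exact: normr_ge0.
- by move=> n; rewrite addr_ge0// mulr_ge0.
- by move=> n; rewrite (le_trans (ler_normD _ _))// normrM.
rewrite (_ : series _ = `|a| *: [normed series u] + [normed series v]).
  by apply: is_cvgD => //; exact: is_cvgZr.
apply/funext => n; rewrite /series/= big_split/=; congr (_ + _).
by rewrite -mulr_sumr.
Qed.

HB.instance Definition _ :=
  GRing.isSubmodClosed.Build R (nat -> R) l1_pred l1_submod_closed.

Record l1 : Type := L1 { l1_seq :> nat -> R ; _ : l1_seq \in l1_pred }.

HB.instance Definition _ := [isSub for l1_seq].
HB.instance Definition _ := [Choice of l1 by <:].
HB.instance Definition _ := [SubChoice_isSubLmodule of l1 by <:].

Lemma l1_cvg (x : l1) : cvgn [normed series x].
Proof. by case: x => x /=; rewrite inE. Qed.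

Definition l1_norm (x : l1) : R := limn [normed series x].

Lemma l1_normD (x y : l1) : l1_norm (x + y) <= l1_norm x + l1_norm y.
Proof.
rewrite /l1_norm -limD; [|exact: l1_cvg|exact: l1_cvg].
apply: ler_lim; first exact: l1_cvg.
  by apply: is_cvgD; exact: l1_cvg.
apply: nearW => n.
rewrite -[leRHS]/(\sum_(0 <= k < n) `|x k| + \sum_(0 <= k < n) `|y k|).
by rewrite -big_split; apply: ler_sum => k _; exact: ler_normD.
Qed.

Lemma l1_normZ (a : R) (x : l1) : l1_norm (a *: x) = `|a| * l1_norm x.
Proof.
rewrite /l1_norm (_ : [normed series _] = `|a| *: [normed series x]).
  by rewrite limZr//; exact: l1_cvg.
apply/funext => n.
rewrite -[RHS]/(`|a| * \sum_(0 <= k < n) `|x k|) mulr_sumr.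
by apply: eq_bigr => k _; exact: normrM.
Qed.

Lemma l1_norm0_eq0 (x : l1) : l1_norm x = 0 -> x = 0.
Proof.
move=> x0; apply/val_inj/funext => k /=.
apply/eqP; rewrite -normr_le0 -x0.
apply: limr_ge; first exact: l1_cvg.
near=> n.
have kn : (k < n)%N by near: n; exact: nbhs_infty_gt.
rewrite -[leRHS]/(\sum_(0 <= i < n) `|x i|) big_mkord (bigD1 (Ordinal kn))//=.
by rewrite lerDl; apply: sumr_ge0.
Unshelve. all: by end_near. Qed.

HB.instance Definition _ :=
  Lmodule_isNormed.Build R l1 l1_normD l1_normZ l1_norm0_eq0.

End l1_space.

(* Extended-real valued: +oo exactly when f is unbounded on the unit ball. *)
Definition opnorm (R : realType) (V W : normedModType R) (f : V -> W) : \bar R :=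
  ereal_sup [set `|f x|%:E | x in [set x : V | `|x| <= 1]].

Definition has_matrix (R : realType) (M : nat -> nat -> R) (B : l1 R -> l1 R) :=
  forall (x : l1 R) (j : nat), series (fun k => M j k * x k) @ \oo --> B x j.

(* Boundedness is not required explicitly: the column sum condition gives
   `|B x| <= `|x|. *)
Definition semibistochastic (R : realType) : set {linear l1 R -> l1 R} :=
  [set B | exists M : nat -> nat -> R,
    [/\ has_matrix M B,
        forall j k, 0 <= M j k,
        forall k, (\sum_(0 <= j <oo) (M j k)%:E <= 1)%E &
        forall j, (\sum_(0 <= k <oo) (M j k)%:E <= 1)%E]].

(* Main.v *)
(** An operator [T] has a semibistochastic matrix iff it is continuous and the
    numbers [T e_k j], for [e_k] the standard basis of l^1, are nonnegative
    with all finite partial row and column sums at most 1: continuity makes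
    [T] commute with the expansion [x = \sum_k x_k e_k], and conversely the
    column condition makes [T] a contraction.  In this form closedness is
    immediate, since coordinates of [B_n e_k] converge to those of [B e_k].
    For a product, the column sums of [A B] are bounded by
    [`|A (B e_k)| <= `|e_k|], and the row sums are coordinates of [A y] with
    [y = \sum_(k < n) B e_k], whose coordinates are at most 1; hence no double
    series has to be rearranged. *)

Require Import Defs.
From mathcomp Require Import all_boot all_order all_algebra.
From mathcomp Require Import all_classical all_reals all_analysis.

Import Order.TTheory GRing.Theory Num.Theory.
Import numFieldNormedType.Exports.

Local Open Scope classical_set_scope.
Local Open Scope ring_scope.

(** * Coordinates, standard basis and truncations in l^1 *)

Section l1_basis.
Set Implicit Arguments.
Unset Strict Implicit.
Context {R : realType}.
Implicit Types (x y : l1 R) (T : {linear l1 R -> l1 R}).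

Lemma l1_sumE I (r : seq I) (F : I -> l1 R) j :
  (\sum_(i <- r) F i) j = \sum_(i <- r) F i j.
Proof. exact: (big_morph (fun x : l1 R => x j)). Qed.

Lemma l1_normE x : `|x| = limn [normed series x].
Proof. by []. Qed.

Lemma l1_sum_le_norm x n : \sum_(0 <= k < n) `|x k| <= `|x|.
Proof.
rewrite l1_normE -[leLHS]/([normed series x] n).
apply: nondecreasing_cvgn_le; last exact: l1_cvg.
by apply: nondecreasing_series => k _ _; exact: normr_ge0.
Qed.

Lemma l1_norm_le x c :
  (forall n, \sum_(0 <= k < n) `|x k| <= c) -> `|x| <= c.
Proof. by move=> xc; rewrite l1_normE; apply: limr_le; [exact: l1_cvg|exact: nearW]. Qed.

Lemma l1_coord_le_norm x j : `|x j| <= `|x|.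
Proof.
apply: le_trans (l1_sum_le_norm x j.+1).
by rewrite big_nat_recr//= lerDr sumr_ge0.
Qed.

Lemma cvg_l1_coord (u : nat -> l1 R) x j :
  u n @[n --> \oo] --> x -> u n j @[n --> \oo] --> x j.
Proof.
move=> /cvgrPdist_le ux; apply/cvgrPdist_le => e e0.
near=> n; apply: le_trans (l1_coord_le_norm (x - u n) j) _.
by near: n; exact: ux.
Unshelve. all: by end_near. Qed.

Lemma sum_nat_pred1 (F : nat -> R) k n :
  \sum_(0 <= i < n) F i * (i == k)%:R = if (k < n)%N then F k else 0.
Proof.
elim: n => [|n IH]; first by rewrite big_geq.
rewrite big_nat_recr//= IH ltnS (leq_eqVlt k n).
have [->|kn] := eqVneq k n; first by rewrite ltnn add0r mulr1.
by rewrite mulr0 addr0.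
Qed.

Lemma sum_norm_pred1_le1 k n : \sum_(0 <= i < n) `|(i == k)%:R : R| <= 1.
Proof.
under eq_bigr do rewrite normr_nat -[_%:R]mul1r.
by rewrite (sum_nat_pred1 (fun=> 1)); case: ifP.
Qed.

Lemma l1_delta_subproof k : (fun i => (i == k)%:R : R) \in @l1_pred R.
Proof.
rewrite inE/=; apply: nondecreasing_is_cvgn.
  by apply: nondecreasing_series => i _ _; exact: normr_ge0.
by exists 1 => _ [n _ <-]; exact: sum_norm_pred1_le1.
Qed.

Definition l1_delta k : l1 R := L1 (l1_delta_subproof k).

Lemma l1_norm_delta k : `|l1_delta k| <= 1.
Proof. by apply: l1_norm_le => n; exact: sum_norm_pred1_le1. Qed.

Lemma l1_truncE x n i :
  (\sum_(0 <= k < n) x k *: l1_delta k) i = if (i < n)%N then x i else 0.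
Proof.
rewrite l1_sumE -sum_nat_pred1; apply: eq_bigr => k _.
by rewrite -[LHS]/(x k * (i == k)%:R) eq_sym.
Qed.

Lemma l1_tailE x n i :
  (x - \sum_(0 <= k < n) x k *: l1_delta k) i = if (i < n)%N then 0 else x i.
Proof.
transitivity (x i - (\sum_(0 <= k < n) x k *: l1_delta k) i); first by [].
by rewrite l1_truncE; case: ifP; rewrite ?subrr ?subr0.
Qed.

(** The tail after [n] terms has norm at most [|x|] minus the [n]-th partial sum of the norm series,
    and this difference tends to 0. *)
Lemma cvg_l1_trunc x :
  (\sum_(0 <= k < n) x k *: l1_delta k) @[n --> \oo] --> x.
Proof.
apply/cvgrPdist_le => e e0.
have /cvgrPdist_le /(_ e e0) : [normed series x] @ \oo --> `|x| := @l1_cvg R x.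
apply: filterS => n; apply: le_trans.
rewrite ger0_norm; last by rewrite subr_ge0; exact: l1_sum_le_norm.
apply: l1_norm_le => m; under eq_bigr do rewrite l1_tailE.
(* The range up to [n + m] contains both the first [m] indices, where the tail is summed, and the
   first [n], where the tail vanishes. It is split at [m] to enlarge the tail sum, then at [n] to
   compare with [x]. *)
rewrite lerBrDr; apply: le_trans (l1_sum_le_norm x (n + m)).
rewrite -[X in _ + X]/(\sum_(0 <= k < n) `|x k|).
apply: (@le_trans _ _ (\sum_(0 <= i < n + m) `|if (i < n)%N then 0 else x i|
                      + \sum_(0 <= k < n) `|x k|)).
  rewrite lerD2r [leRHS](big_cat_nat (leq0n _) (leq_addl n m)) /=.
  by rewrite lerDl sumr_ge0.
rewrite [leLHS]addrC !(big_cat_nat (leq0n _) (leq_addr m n)) /= lerD2l.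
rewrite big_nat_cond big1 ?add0r.
  rewrite [leLHS]big_nat_cond [leRHS]big_nat_cond.
  by apply: ler_sum => i /andP[/andP[ni _] _]; rewrite ltnNge ni.
by move=> i /andP[/andP[_ ni] _]; rewrite ni normr0.
Qed.

(** By linearity, coordinate [j] of [T] at a truncation of [x] is a partial sum of the matrix
    series; truncations converge to [x], and coordinates are continuous. *)
Lemma continuous_has_matrix T :
  continuous T -> has_matrix (fun j k => T (l1_delta k) j) T.
Proof.
move=> cT x j.
have : T (\sum_(0 <= k < n) x k *: l1_delta k) j @[n --> \oo] --> T x j.
  apply: cvg_l1_coord; apply: continuous_cvg; first exact: cT.
  exact: cvg_l1_trunc.
apply: cvg_trans.
apply: near_eq_cvg; apply: nearW => n.
rewrite linear_sum l1_sumE; apply: eq_bigr => k _.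
by rewrite linearZ mulrC.
Qed.

(** Uniqueness of the matrix: at a basis vector the partial sums of the matrix series are constant
    once they pass index [k]. *)
Lemma has_matrix_delta T M : has_matrix M T ->
  M = fun j k => T (l1_delta k) j.
Proof.
move=> MT; apply/funext => j; apply/funext => k.
have := MT (l1_delta k) j; move/(cvg_lim _) => <- //.
apply/esym/cvg_lim => //; apply: cvg_near_cst.
near=> n; rewrite /series/= sum_nat_pred1.
suff -> : (k < n)%N by [].
by near: n; exact: nbhs_infty_gt.
Unshelve. all: by end_near. Qed.

End l1_basis.

(** * Matrix estimates and the characterization by basis vectors *)

Section semibistochastic_theory.
Set Implicit Arguments.
Unset Strict Implicit.
Context {R : realType}.
Implicit Types (x y : l1 R) (T : {linear l1 R -> l1 R}).

Lemma nneseries_leP (u : nat -> R) c : (forall k, 0 <= u k) ->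
  (\sum_(0 <= k <oo) (u k)%:E <= c%:E)%E <->
  (forall n, \sum_(0 <= k < n) u k <= c).
Proof.
move=> u0; split=> [uc n|uc].
  rewrite -lee_fin -sumEFin; apply: le_trans uc.
  by apply: nneseries_lim_ge => k _ _; rewrite lee_fin.
apply: lime_le; first by apply: is_cvg_nneseries => k _ _; rewrite lee_fin.
by apply: nearW => n; rewrite sumEFin lee_fin.
Qed.

Lemma has_matrix_norm_le T M : has_matrix M T -> (forall j k, 0 <= M j k) ->
  (forall k n, \sum_(0 <= j < n) M j k <= 1) -> forall x, `|T x| <= `|x|.
Proof.
move=> MT M0 Mcol x; apply: l1_norm_le => m.
(* With [m] fixed, only [n] goes to infinity, so the exchange of summations below concerns finite
   sums. *)
have : \sum_(0 <= j < m) `|series (fun k => M j k * x k) n| @[n --> \oo]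
         --> \sum_(0 <= j < m) `|T x j|.
  by apply: cvg_big => [|j _]; [exact: add_continuous|apply: cvg_norm; exact: MT].
move=> /cvgr_to_le; apply; apply: nearW => n.
apply: le_trans (l1_sum_le_norm x n).
apply: (@le_trans _ _ (\sum_(0 <= j < m) \sum_(0 <= k < n) M j k * `|x k|)).
  apply: ler_sum => j _; apply: le_trans (ler_norm_sum _ _ _) _.
  by apply: ler_sum => k _; rewrite normrM ger0_norm.
rewrite exchange_big; apply: ler_sum => k _.
by rewrite -mulr_suml ler_piMl.
Qed.

Lemma has_matrix_ge0 T M x : has_matrix M T -> (forall j k, 0 <= M j k) ->
  (forall k, 0 <= x k) -> forall j, 0 <= T x j.
Proof.
move=> MT M0 x0 j; apply: (cvgr_to_ge (MT x j)); apply: nearW => n.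
by rewrite sumr_ge0// => k _; rewrite mulr_ge0.
Qed.

(** Each partial sum is dominated by a partial row sum. The bound is coordinatewise, so it applies
    to vectors of large norm such as a sum of many columns. *)
Lemma has_matrix_le1 T M x j : has_matrix M T -> (forall k, 0 <= M j k) ->
  (forall n, \sum_(0 <= k < n) M j k <= 1) ->
  (forall k, x k <= 1) -> T x j <= 1.
Proof.
move=> MT M0 Mrow x1; apply: (cvgr_to_le (MT x j)); apply: nearW => n.
by apply: le_trans (Mrow n); apply: ler_sum => k _; rewrite ler_piMr.
Qed.

Lemma norm_le_continuous T : (forall x, `|T x| <= `|x|) -> continuous T.
Proof.
move=> T1; apply/linear_bounded_continuous/bounded_funP => r.
by exists r => x; apply: le_trans (T1 x).
Qed.

Lemma semibistochasticP T : semibistochastic T <->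
  [/\ continuous T,
      forall j k, 0 <= T (l1_delta k) j,
      forall k n, \sum_(0 <= j < n) T (l1_delta k) j <= 1 &
      forall j n, \sum_(0 <= k < n) T (l1_delta k) j <= 1].
Proof.
split=> [[M [MT M0 Mcol Mrow]]|[cT T0 Tcol Trow]].
  have ME := has_matrix_delta MT.
  have {}Mcol k : forall n, \sum_(0 <= j < n) M j k <= 1 by exact/nneseries_leP.
  have {}Mrow j : forall n, \sum_(0 <= k < n) M j k <= 1 by exact/nneseries_leP.
  have /norm_le_continuous cT := has_matrix_norm_le MT M0 Mcol.
  by rewrite ME in M0 Mcol Mrow.
exists (fun j k => T (l1_delta k) j); split => // [|k|j].
- exact: continuous_has_matrix.
- exact/nneseries_leP.
- exact/nneseries_leP.
Qed.

(** * Products *)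

Lemma semibistochastic_comp (A B : {linear l1 R -> l1 R}) :
  semibistochastic A -> semibistochastic B ->
  semibistochastic (A \o B : {linear l1 R -> l1 R}).
Proof.
move=> /semibistochasticP[cA A0 Acol Arow] /semibistochasticP[cB B0 Bcol Brow].
have MA := continuous_has_matrix cA; have MB := continuous_has_matrix cB.
have AB0 j k : 0 <= A (B (l1_delta k)) j by exact: has_matrix_ge0 MA A0 _ _.
apply/semibistochasticP; split => //= [x|k n|j n].
- by apply: continuous_comp; [exact: cB|exact: cA].
- apply: le_trans (l1_norm_delta k).
  apply: le_trans (has_matrix_norm_le MB B0 Bcol _).
  apply: le_trans (has_matrix_norm_le MA A0 Acol _).
  apply: le_trans (l1_sum_le_norm _ n).
  by apply: ler_sum => j _; exact: ler_norm.
- rewrite -l1_sumE -linear_sum; apply: (has_matrix_le1 MA (A0 j) (Arow j)) => i.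
  by rewrite l1_sumE; exact: Brow.
Qed.

(** * Limits in operator norm *)

Lemma le_opnorm (V W : normedModType R) (f : V -> W) (x : V) :
  `|x| <= 1 -> (`|f x|%:E <= opnorm f)%E.
Proof. by move=> x1; apply: ereal_sup_ubound; exists x. Qed.

Lemma cvg_opnorm (V W : normedModType R) (f_ : nat -> V -> W) (f : V -> W) (x : V) :
  opnorm (f_ n \- f) @[n --> \oo] --> (0 : \bar R)%E -> `|x| <= 1 ->
  f_ n x @[n --> \oo] --> f x.
Proof.
(* Finitely many of the norms may be infinite; convergence to 0 makes them eventually finite, hence
   comparable with [e] as reals. *)
move=> /fine_cvgP[finf /cvgrPdist_le cf] x1; apply/cvgrPdist_le => e e0.
near=> n; rewrite distrC.
have fn : opnorm (f_ n \- f) \is a fin_num by near: n.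
have : `|0 - fine (opnorm (f_ n \- f))| <= e by near: n; exact: cf.
rewrite sub0r normrN; apply: le_trans; apply: le_trans (ler_norm _).
by rewrite -lee_fin fineK//; exact: (le_opnorm (f_ n \- f)).
Unshelve. all: by end_near. Qed.

Lemma semibistochastic_closed
    (B_ : nat -> {linear l1 R -> l1 R}) (B : {linear l1 R -> l1 R}) :
  (forall n, semibistochastic (B_ n)) -> bounded_fun_norm B ->
  opnorm (B_ n \- B) @[n --> \oo] --> (0 : \bar R)%E ->
  semibistochastic B.
Proof.
move=> sB bB cB.
have cvgB k j : B_ n (l1_delta k) j @[n --> \oo] --> B (l1_delta k) j.
  by apply: cvg_l1_coord; apply: cvg_opnorm cB (l1_norm_delta k).
(* Summing over an arbitrary finite list of (column, row) pairs treats partial column sums and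
   partial row sums at once. *)
have sumB_le1 (s : seq (nat * nat)) :
    (forall n, \sum_(p <- s) B_ n (l1_delta p.1) p.2 <= 1) ->
    \sum_(p <- s) B (l1_delta p.1) p.2 <= 1.
  move=> s1.
  have : \sum_(p <- s) B_ n (l1_delta p.1) p.2 @[n --> \oo]
      --> \sum_(p <- s) B (l1_delta p.1) p.2.
    by apply: cvg_big => [|p _]; [exact: add_continuous|exact: cvgB].
  by move=> /cvgr_to_le; apply; exact: nearW.
apply/semibistochasticP; split.
- by apply/linear_bounded_continuous/bounded_funP; exact: bB.
- move=> j k; apply: (cvgr_to_ge (cvgB k j)); apply: nearW => n.
  by have /semibistochasticP[] := sB n.
- move=> k n; have := sumB_le1 [seq (k, j) | j <- index_iota 0 n].
  rewrite big_map; apply => m; rewrite big_map.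
  by have /semibistochasticP[_ _ + _] := sB m; apply.
- move=> j n; have := sumB_le1 [seq (k, j) | k <- index_iota 0 n].
  rewrite big_map; apply => m; rewrite big_map.
  by have /semibistochasticP[_ _ _] := sB m; apply.
Qed.

End semibistochastic_theory.

Theorem lemma3p5 (R : realType) :
  (forall A B : {linear l1 R -> l1 R},
     semibistochastic A -> semibistochastic B ->
     semibistochastic (A \o B : {linear l1 R -> l1 R})) /\
  (forall (B_ : nat -> {linear l1 R -> l1 R}) (B : {linear l1 R -> l1 R}),
     (forall n, semibistochastic (B_ n)) ->
     bounded_fun_norm B ->
     opnorm (B_ n \- B) @[n --> \oo] --> (0 : \bar R)%E ->
     semibistochastic B).

Proof.
split=> [A B|B_ B]; first exact: semibistochastic_comp.
exact: semibistochastic_closed.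
Qed.
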